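(* Let $\gamma>0$, $\Delta t>0$, and let $u^n=(u_1^n,\ldots,u_{N_h}^n)$ be given cell averages with bounds $u_i^{\min},u_i^{\max}$ satisfying $$u_i^{\min}\le\min_{j\in\mathcal V_i}u^n_j\le\max_{j\in\mathcal V_i}u^n_j\le u_i^{\max},\qquad i=1,\ldots,N_h.$$ Let the limited fluxes $F_{ij}^*$ be calculated from the antidiffusive fluxes $F_{ij}$ at $u=u^n$ using either the LMC (local monolithic convex) limiter or the GMC (global monolithic convex) limiter with parameter $\gamma$, and let $$u_i^{n+1}=u_i^n+\frac{\Delta t\,d_i}{|K_i|}\,(\bar u_i^*-u_i^n),\qquad \bar u_i^*=\bar u_i^L+\frac1{d_i}\sum_{j\in\mathcal N_i}F_{ij}^*,$$ be the forward Euler update of the flux-corrected scheme. If $$(1+\gamma)\frac{\Delta t\,d_i}{|K_i|}\le 1,\qquad i=1,\ldots,N_h,$$ then $u_i^{n+1}\in[u_i^{\min},u_i^{\max}]$ for all $i=1,\ldots,N_h$.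
   Context: The scheme discretizes the scalar conservation law $\partial_t u+\nabla\cdot\mathbf f(u)=0$ with (continuously differentiable) flux $\mathbf f:\mathbb R\to\mathbb R^d$, $d\in\{1,2,3\}$, on a hyperrectangle with periodic boundary conditions, partitioned into finitely many cells $K_1,\ldots,K_{N_h}$ of volume $|K_i|>0$. $\mathcal N_i$ is the (nonempty) set of indices $j\ne i$ of cells sharing a face $S_{ij}=\partial K_i\cap\partial K_j$ of positive area $|S_{ij}|$ with $K_i$; $\mathbf n_{ij}=-\mathbf n_{ji}$ is the constant unit normal on $S_{ij}$ pointing out of $K_i$. $\mathcal V_i$ is the set containing $i$ and the indices of all cells that share a vertex with $K_i$ (so $\mathcal N_i\subset\mathcal V_i$). $\lambda_{ij}=\lambda_{ji}>0$ is an upper bound for the wave speed of the Riemann problem associated with $S_{ij}$, i.e. $|\mathbf f'(v)\cdot\mathbf n_{ij}|\le\lambda_{ij}$ for all $v$ between $u_i$ and $u_j$. For cell averages $u=(u_1,\dots,u_{N_h})$ set $$\bar u_{ij}^L=\frac{u_j+u_i}{2}-\frac{\mathbf f(u_j)-\mathbf f(u_i)}{2\lambda_{ij}}\cdot\mathbf n_{ij},\qquad d_i=\sum_{j\in\mathcal N_i}|S_{ij}|\lambda_{ij},\qquad \bar u_i^L=\frac1{d_i}\sum_{j\in\mathcal N_i}|S_{ij}|\lambda_{ij}\bar u_{ij}^L.$$ The Lax-Friedrichs flux is $H(v,w,\mathbf n_{ij})=\frac{\mathbf f(w)+\mathbf f(v)}2\cdot\mathbf n_{ij}-\frac{\lambda_{ij}}2(w-v)$.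 The antidiffusive fluxes are $F_{ij}=\int_{S_{ij}}[H(u_i,u_j,\mathbf n_{ij})-H(\hat u_i,\hat u_j,\mathbf n_{ij})]\,\mathrm ds$, where $\hat u_i$ is a polynomial reconstruction in $K_i$ obtained from the cell averages; hence $F_{ji}=-F_{ij}$. GMC limiter: set $$Q_i^-=d_i[(u_i^{\min}-\bar u_i^L)+\gamma(u_i^{\min}-u_i)],\quad Q_i^+=d_i[(u_i^{\max}-\bar u_i^L)+\gamma(u_i^{\max}-u_i)],$$ $$P_i^+=\sum_{j\in\mathcal N_i}\max\{0,F_{ij}\},\quad P_i^-=\sum_{j\in\mathcal N_i}\min\{0,F_{ij}\},\quad R_i^\pm=\min\{1,Q_i^\pm/P_i^\pm\}$$ (with $R_i^\pm=1$ if $P_i^\pm=0$), and $F_{ij}^*=\alpha_{ij}F_{ij}$ with $\alpha_{ij}=\min\{R_i^+,R_j^-\}$ if $F_{ij}>0$, $\alpha_{ij}=1$ if $F_{ij}=0$, $\alpha_{ij}=\min\{R_i^-,R_j^+\}$ if $F_{ij}<0$. LMC limiter: set $$Q_{ij}^-=|S_{ij}|\lambda_{ij}[(u_i^{\min}-\bar u_{ij}^L)+\gamma(u_i^{\min}-u_i)],\quad Q_{ij}^+=|S_{ij}|\lambda_{ij}[(u_i^{\max}-\bar u_{ij}^L)+\gamma(u_i^{\max}-u_i)],$$ and $F_{ij}^*=\min\{Q_{ij}^+,F_{ij},-Q_{ji}^-\}$ if $F_{ij}>0$, $F_{ij}^*=\max\{Q_{ij}^-,F_{ij},-Q_{ji}^+\}$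 otherwise. All quantities are evaluated at $u=u^n$. *)

(* Defs.v *)
(* MathComp-Analysis; real numbers are an arbitrary [R : realType]. *)
From mathcomp Require Import all_boot all_order all_algebra.
From mathcomp Require Import all_classical all_reals all_analysis.
(* Not imported: its notations clash with those of MathComp-Analysis. *)
From mathcomp Require mpoly.

Set Implicit Arguments.
Unset Strict Implicit.
Unset Printing Implicit Defensive.

Import Order.TTheory GRing.Theory Num.Theory.
Import numFieldNormedType.Exports.

Local Open Scope classical_set_scope.
Local Open Scope ring_scope.

Section Space.
Context {R : realType} {d : nat}.
Implicit Types (x y : 'rV[R]_d) (A B : set 'rV[R]_d).

Definition dotp x y : R := \sum_(k < d) x 0 k * y 0 k.

Definition edist x y : R := Num.sqrt (dotp (x - y) (x - y)).

Definition bdry A : set 'rV[R]_d := closure A `\` interior A.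

Definition box (a b : 'rV[R]_d) : set 'rV[R]_d :=
  [set x | forall k, a 0 k <= x 0 k <= b 0 k].

(* d-dimensional Lebesgue (outer) measure, by countable covers by boxes. *)
Definition lebesgue_vol A : \bar R :=
  ereal_inf [set (\sum_(0 <= m <oo)
                    (\prod_(k < d) (ab.2 m 0 k - ab.1 m 0 k))%:E)%E
            | ab in [set ab : (nat -> 'rV[R]_d) * (nat -> 'rV[R]_d) |
                (forall m k, ab.1 m 0 k <= ab.2 m 0 k) /\
                A `<=` \bigcup_m box (ab.1 m) (ab.2 m)]].

(* Empty sets have diameter -oo. *)
Definition ediam A : \bar R :=
  ereal_sup [set (edist p.1 p.2)%:E | p in A `*` A].

(* Volume of the s-dimensional ball of diameter 1: 1, 1, pi/4, pi/6, ...
   The recurrence is omega_(s+2) = (2 pi / (s+2)) omega_s for unit balls. *)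
Fixpoint ball_coef (s : nat) : R :=
  match s with
  | 0%N | 1%N => 1
  | s'.+2 => pi / (2 * s'.+2%:R) * ball_coef s'
  end.

Definition gauge (s : nat) A : R :=
  if `[< A = set0 >] then 0 else ball_coef s * fine (ediam A) ^+ s.

(* s-dimensional Hausdorff (outer) measure, normalised so that it is the usual
   length/area on s-dimensional planar sets and counting for s = 0. *)
Definition hausdorff (s : nat) A : \bar R :=
  ereal_sup [set ereal_inf [set (\sum_(0 <= m <oo) (gauge s (U m))%:E)%E
                           | U in [set U : nat -> set 'rV[R]_d |
                               A `<=` \bigcup_m U m /\
                               forall m, (ediam (U m) <= delta%:E)%E]]
            | delta in [set delta : R | 0 < delta]].

Definition period (L : 'rV[R]_d) (z : 'rV[int]_d) : 'rV[R]_d :=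
  \row_k ((z 0 k)%:~R * L 0 k).

(* Points common to the boundaries of A and of the translate B + t. *)
Definition common_bdry A B (t : 'rV[R]_d) : set 'rV[R]_d :=
  bdry A `&` [set x | bdry B (x - t)].

End Space.

(* R^d with its Borel sigma-algebra; convertible to 'rV[R]_d. *)
Notation borel_space R d := (g_sigma_algebraType (@open 'rV[R]_d)).

(* A partition of the periodic hyperrectangle box(lo, hi) into N cells.  Cells
   are closed subsets of the hyperrectangle.  The periodic identification is
   expressed by integer translations: the copy of cell j which is adjacent to
   cell i is K_j + period (hi - lo) (wrap i j). *)
Record mesh (R : realType) (d N : nat) := Mesh {
  lo : 'rV[R]_d;
  hi : 'rV[R]_d;
  cell : 'I_N -> set 'rV[R]_d;
  vertices : 'I_N -> seq 'rV[R]_d;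
  wrap : 'I_N -> 'I_N -> 'rV[int]_d;
  normal : 'I_N -> 'I_N -> 'rV[R]_d;

  shift i j := period (hi - lo) (wrap i j);
  face i j := common_bdry (cell i) (cell j) (shift i j);
  area i j := fine (hausdorff d.-1 (face i j));
  vol i := fine (lebesgue_vol (cell i));
  nbr i j := (j != i) && (0 < area i j);
  vnbr i j := (j == i) ||
    `[< exists (z : 'rV[int]_d) (x : 'rV[R]_d),
          x \in vertices i /\ x - period (hi - lo) z \in vertices j >];

  lo_lt_hi : forall k, lo 0 k < hi 0 k;
  cell_closed : forall i, closed (cell i);
  cell_cover : \bigcup_i cell i = box lo hi;
  cell_disj : forall i j, i != j ->
    interior (cell i) `&` interior (cell j) = set0;
  vol_gt0 : forall i, 0 < vol i;
  vertices_bdry : forall i x, x \in vertices i -> bdry (cell i) x;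
  wrapN : forall i j, wrap j i = - wrap i j;
  (* Two cells share at most one face (a constant normal is attached to it). *)
  wrap_uniq : forall i j (z : 'rV[int]_d), i != j ->
    0 < fine (hausdorff d.-1
                (common_bdry (cell i) (cell j) (period (hi - lo) z))) ->
    z = wrap i j;
  nbr_ex : forall i, exists j, nbr i j;
  nbr_vnbr : forall i j, nbr i j -> vnbr i j;
  normal_unit : forall i j, nbr i j -> dotp (normal i j) (normal i j) = 1;
  normalN : forall i j, nbr i j -> normal i j = - normal j i;
  (* Up to a set of area zero (lower-dimensional contacts), the face lies in a
     hyperplane orthogonal to the normal, which points out of cell i there. *)
  normal_outward : forall i j, nbr i j -> exists c : R,
    hausdorff d.-1 [set x | face i j x /\
      ~ (dotp (normal i j) x = c /\
         exists2 e : R, 0 < e & forall t : R, 0 < t < e ->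
           cell i (x - t *: normal i j) /\ ~ cell i (x + t *: normal i j))]
    = 0%E
}.

Inductive limiter := LMC | GMC.

Section Scheme.
Context {R : realType} {d N : nat}.
Variables (M : mesh R d N) (f : R -> 'rV[R]_d).
Variables (lambda : 'I_N -> 'I_N -> R) (u : 'I_N -> R).
(* Polynomial reconstruction in each cell, in the coordinates of that cell. *)
Variable uhat : 'I_N -> mpoly.mpoly d R.
Variables (umin umax : 'I_N -> R) (gamma : R).
Implicit Types i j : 'I_N.

Definition recon i (x : 'rV[R]_d) : R := mpoly.meval (fun k => x 0 k) (uhat i).

Definition ubarL_face i j : R :=
  (u j + u i) / 2 -
  dotp ((2 * lambda i j)^-1 *: (f (u j) - f (u i))) (normal M i j).

Definition diag i : R := \sum_(j | nbr M i j) area M i j * lambda i j.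

Definition ubarL i : R :=
  (diag i)^-1 *
  \sum_(j | nbr M i j) area M i j * lambda i j * ubarL_face i j.

Definition lf_flux i j (v w : R) : R :=
  dotp (2^-1 *: (f w + f v)) (normal M i j) - lambda i j / 2 * (w - v).

(* The trace of the reconstruction of cell j at a point x of the face, given in
   the coordinates of cell i, is taken at the corresponding point of cell j. *)
Definition antidiff i j : R :=
  fine (\int[(hausdorff d.-1 : set (borel_space R d) -> \bar R)]_(x in face M i j)
          (lf_flux i j (u i) (u j) -
           lf_flux i j (recon i x) (recon j (x - shift M i j)))%:E)%E.

Definition gmc_Qm i : R :=
  diag i * ((umin i - ubarL i) + gamma * (umin i - u i)).
Definition gmc_Qp i : R :=
  diag i * ((umax i - ubarL i) + gamma * (umax i - u i)).
Definition gmc_Pp i : R := \sum_(j | nbr M i j) Num.max 0 (antidiff i j).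
Definition gmc_Pm i : R := \sum_(j | nbr M i j) Num.min 0 (antidiff i j).
Definition gmc_Rp i : R :=
  if gmc_Pp i == 0 then 1 else Num.min 1 (gmc_Qp i / gmc_Pp i).
Definition gmc_Rm i : R :=
  if gmc_Pm i == 0 then 1 else Num.min 1 (gmc_Qm i / gmc_Pm i).
Definition gmc_alpha i j : R :=
  if 0 < antidiff i j then Num.min (gmc_Rp i) (gmc_Rm j)
  else if antidiff i j == 0 then 1
  else Num.min (gmc_Rm i) (gmc_Rp j).
Definition gmc_flux i j : R := gmc_alpha i j * antidiff i j.

Definition lmc_Qm i j : R :=
  area M i j * lambda i j *
  ((umin i - ubarL_face i j) + gamma * (umin i - u i)).
Definition lmc_Qp i j : R :=
  area M i j * lambda i j *
  ((umax i - ubarL_face i j) + gamma * (umax i - u i)).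
Definition lmc_flux i j : R :=
  if 0 < antidiff i j
  then Num.min (Num.min (lmc_Qp i j) (antidiff i j)) (- lmc_Qm j i)
  else Num.max (Num.max (lmc_Qm i j) (antidiff i j)) (- lmc_Qp j i).

Definition limited_flux (lim : limiter) i j : R :=
  match lim with LMC => lmc_flux i j | GMC => gmc_flux i j end.

Definition ubar_star (lim : limiter) i : R :=
  ubarL i + (diag i)^-1 * \sum_(j | nbr M i j) limited_flux lim i j.

Definition euler_step (lim : limiter) (dt : R) i : R :=
  u i + dt * diag i / vol M i * (ubar_star lim i - u i).

End Scheme.

(* Main.v *)
(** The bar states of the Lax-Friedrichs scheme lie between [u_i] and [u_j] by
    the mean value theorem, so [Q_ij^- <= 0 <= Q_ij^+].  Each limiter then keeps
    the sum of the limited fluxes of cell [i] between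
    [Q_i^- = \sum_j Q_ij^-] and [Q_i^+ = \sum_j Q_ij^+], which means that
    [ubar_i^* - u_i] lies between [(1 + gamma) (u_i^min - u_i)] and
    [(1 + gamma) (u_i^max - u_i)]; the CFL condition absorbs [1 + gamma]. *)
Require Import Defs.
From mathcomp Require Import all_boot all_order all_algebra.
From mathcomp Require Import all_classical all_reals all_analysis.
From mathcomp Require mpoly.
From mathcomp Require Import ring lra.
Import Order.TTheory GRing.Theory Num.Theory.
Import numFieldNormedType.Exports.
Local Open Scope ring_scope.

(** * Nonnegativity of the Hausdorff measure and of face areas *)

Lemma gauge_ge0 (R : realType) (d s : nat) (A : set 'rV[R]_d) : 0 <= gauge s A.
Proof.
rewrite /gauge; case: asboolP => // /eqP/set0P[x Ax].
(* The recurrence of [ball_coef] has step two, so the induction carries two consecutive values. *)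
have coef_ge0 : forall k, 0 <= ball_coef k :> R /\ 0 <= ball_coef k.+1 :> R.
  elim=> [|k [c0 c1]]; first by rewrite /= ler01.
  by split=> //=; rewrite mulr_ge0// divr_ge0 ?pi_ge0// mulr_ge0.
apply: mulr_ge0; first by have [] := coef_ge0 s.
have xx : Defs.edist x x = 0.
  by rewrite /Defs.edist subrr /dotp big1 ?sqrtr0// => k _; rewrite mxE mul0r.
(* The pair [(x, x)], at distance zero, bounds the diameter of a nonempty set from below. *)
apply/exprn_ge0/fine_ge0/ereal_sup_ubound; exists (x, x); first by split.
by rewrite /= xx.
Qed.

Lemma hausdorff_ge0 (R : realType) (d s : nat) (A : set 'rV[R]_d) :
  (0 <= hausdorff s A)%E.
Proof.
(* The supremum over [delta] dominates its term at [delta = 1]; any positive value would serve. *)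
set inner := ereal_inf [set (\sum_(0 <= m <oo) (gauge s (U m))%:E)%E
   | U in [set U : nat -> set 'rV[R]_d | A `<=` \bigcup_m U m /\
       forall m, (ediam (U m) <= 1%:E)%E]]%classic.
apply: (@le_trans _ _ inner).
  apply: le_ereal_inf_tmp => _ [U _ <-].
  by apply: nneseries_ge0 => m _ _; rewrite lee_fin gauge_ge0.
by apply: ereal_sup_ubound; exists 1 => //=; exact: ltr01.
Qed.

Lemma area_ge0 (R : realType) (d N : nat) (M : mesh R d N) i j :
  0 <= area M i j.
Proof. exact/fine_ge0/hausdorff_ge0. Qed.

(** * Bar states of the Lax-Friedrichs scheme *)

Lemma is_derive_dotp (R : realType) (d : nat) (f : R -> 'rV[R]_d)
    (n : 'rV[R]_d) (v : R) :
  derivable f v 1 ->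
  is_derive v 1 (fun t => dotp (f t) n) (dotp (derive1 f v) n).
Proof.
move=> fv.
have -> : (fun t => dotp (f t) n) = \sum_(k < d) (n 0 k \*: (fun t => f t 0 k)).
  by apply/funext => t; rewrite fct_sumE; apply: eq_bigr => k _; rewrite mulrC.
have -> : dotp (derive1 f v) n =
    \sum_(k < d) n 0 k *: 'D_1 (fun t => f t 0 k) v.
  by rewrite derive1E derive_mx//; apply: eq_bigr => k _; rewrite mxE mulrC.
apply: is_derive_sum => k; apply: is_deriveZ.
by apply: DeriveDef => //; move/derivable_mxP : fv.
Qed.

(** The mean value theorem fails for vector-valued [f], so it is applied to the scalar normal
    flux. *)
Lemma dotp_sub_le (R : realType) (d : nat) (f : R -> 'rV[R]_d)
    (n : 'rV[R]_d) (L a b : R) :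
  (forall v, derivable f v 1) -> a <= b ->
  (forall v, a <= v <= b -> `|dotp (derive1 f v) n| <= L) ->
  `|dotp (f b) n - dotp (f a) n| <= L * (b - a).
Proof.
move=> df ab bound.
have dg v := is_derive_dotp R d f n v (df v).
have [|c cab ->] := MVT_segment ab (fun x _ => dg x).
  by apply: derivable_within_continuous => x _; have [] := dg x.
by rewrite normrM (ger0_norm (x := b - a)) ?subr_ge0//
  ler_wpM2r ?subr_ge0// bound// -in_itv.
Qed.

(** The bar state is the midpoint of [u i] and [u j] shifted by the flux difference over twice the
    wave speed. That shift is at most half the distance of the two states, so it cannot leave the
    interval. *)
Lemma ubarL_face_bounds (R : realType) (d N : nat) (M : mesh R d N)
    (f : R -> 'rV[R]_d) (lambda : 'I_N -> 'I_N -> R) (u : 'I_N -> R) i j :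
  (forall v, derivable f v 1) -> 0 < lambda i j ->
  (forall v, Num.min (u i) (u j) <= v <= Num.max (u i) (u j) ->
     `|dotp (derive1 f v) (normal M i j)| <= lambda i j) ->
  Num.min (u i) (u j) <= ubarL_face M f lambda u i j <= Num.max (u i) (u j).
Proof.
move=> df l0 bound; rewrite /ubarL_face; set n := normal M i j.
set D := dotp (f (u j)) n - dotp (f (u i)) n.
have -> : dotp ((2 * lambda i j)^-1 *: (f (u j) - f (u i))) n =
    (2 * lambda i j)^-1 * D.
  rewrite /D /dotp -sumrB mulr_sumr; apply: eq_bigr => k _.
  by rewrite !mxE -mulrA mulrBl.
have hD : `|D| <= lambda i j * (Num.max (u i) (u j) - Num.min (u i) (u j)).
  case: (leP (u i) (u j)) bound => uij bound; first exact: dotp_sub_le.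
  by rewrite /D distrC; apply: dotp_sub_le => //; exact: ltW.
have {hD} : `|(2 * lambda i j)^-1 * D| <=
    (Num.max (u i) (u j) - Num.min (u i) (u j)) / 2.
  rewrite normrM gtr0_norm ?invr_gt0 ?mulr_gt0//.
  by rewrite ler_pdivrMl ?mulr_gt0//; apply: le_trans hD _; lra.
rewrite ler_norml.
by case: (leP (u i) (u j)) => uij /andP[? ?]; apply/andP; split; lra.
Qed.

(** * Bounds on the sums of limited fluxes *)

Section LimitedFluxes.
Context {R : realType} {d N : nat}.
Variables (M : mesh R d N) (f : R -> 'rV[R]_d).
Variables (lambda : 'I_N -> 'I_N -> R) (u : 'I_N -> R).
Variables (uhat : 'I_N -> mpoly.mpoly d R).
Variables (umin umax : 'I_N -> R) (gamma : R).
Hypothesis lambda_gt0 : forall i j, nbr M i j -> 0 < lambda i j.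
Hypothesis gamma_ge0 : 0 <= gamma.
Hypothesis u_bounds : forall i, umin i <= u i <= umax i.
Hypothesis face_bounds : forall i j, nbr M i j ->
  umin i <= ubarL_face M f lambda u i j <= umax i.

Local Notation F := (antidiff M f lambda u uhat).
Local Notation lQm := (lmc_Qm M f lambda u umin gamma).
Local Notation lQp := (lmc_Qp M f lambda u umax gamma).
Local Notation gQm := (gmc_Qm M f lambda u umin gamma).
Local Notation gQp := (gmc_Qp M f lambda u umax gamma).
Local Notation Pm := (gmc_Pm M f lambda u uhat).
Local Notation Pp := (gmc_Pp M f lambda u uhat).
Local Notation Rm := (gmc_Rm M f lambda u uhat umin gamma).
Local Notation Rp := (gmc_Rp M f lambda u uhat umax gamma).
Local Notation flux := (limited_flux M f lambda u uhat umin umax gamma).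

Lemma diag_gt0 i : 0 < diag M lambda i.
Proof.
have [j ij] := nbr_ex M i.
have pos k : nbr M i k -> 0 < area M i k * lambda i k.
  by move=> ik; rewrite mulr_gt0 ?lambda_gt0//; case/andP: ik.
rewrite /diag (bigD1 j)//= ltr_pwDl ?pos//.
by apply: sumr_ge0 => k /andP[ik _]; exact/ltW/pos.
Qed.

Lemma diag_ubarL i : diag M lambda i * ubarL M f lambda u i =
  \sum_(j | nbr M i j) area M i j * lambda i j * ubarL_face M f lambda u i j.
Proof. by rewrite mulVKf// gt_eqF// diag_gt0. Qed.

(** The weights [area * lambda] sum to [diag] and average the face bar states to [ubarL]. Hence
    facewise signs and bounds carry over to the GMC quantities. *)
Lemma sum_lmc_Qm i : \sum_(j | nbr M i j) lQm i j = gQm i.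
Proof.
rewrite /gmc_Qm mulrDr mulrBr diag_ubarL /diag !mulr_suml -sumrB -big_split/=.
by apply: eq_bigr => j _; rewrite /lmc_Qm; ring.
Qed.

Lemma sum_lmc_Qp i : \sum_(j | nbr M i j) lQp i j = gQp i.
Proof.
rewrite /gmc_Qp mulrDr mulrBr diag_ubarL /diag !mulr_suml -sumrB -big_split/=.
by apply: eq_bigr => j _; rewrite /lmc_Qp; ring.
Qed.

(* [Q_ji] enters the LMC flux of the pair (i, j), and the sign of [lambda j i] is
   only known when [nbr M j i]; otherwise [Q_ji] vanishes with the area, so the
   symmetry of [nbr] (invariance of [hausdorff] under translations) is avoided. *)
Lemma area_eq0_or_nbr i j : i != j -> area M i j = 0 \/ nbr M i j.
Proof.
move=> ij; rewrite /nbr eq_sym ij /=.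
by have := area_ge0 R d N M i j; rewrite le_eqVlt => /predU1P[|]; [left|right].
Qed.

(** * The LMC limiter *)

Lemma lmc_Qm_le0 i j : i != j -> lQm i j <= 0.
Proof.
rewrite /lmc_Qm => /area_eq0_or_nbr[->|ij]; first by rewrite !mul0r.
have /andP[fm _] := face_bounds _ _ ij; have /andP[um _] := u_bounds i.
apply: mulr_ge0_le0; first by rewrite mulr_ge0 ?area_ge0// ltW// lambda_gt0.
by rewrite -[leRHS]addr0 lerD ?mulr_ge0_le0 ?subr_le0.
Qed.

Lemma lmc_Qp_ge0 i j : i != j -> 0 <= lQp i j.
Proof.
rewrite /lmc_Qp => /area_eq0_or_nbr[->|ij]; first by rewrite !mul0r.
have /andP[_ fm] := face_bounds _ _ ij; have /andP[_ um] := u_bounds i.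
apply: mulr_ge0; first by rewrite mulr_ge0 ?area_ge0// ltW// lambda_gt0.
by rewrite addr_ge0 ?subr_ge0// mulr_ge0// subr_ge0.
Qed.

Lemma gmc_Qm_le0 i : gQm i <= 0.
Proof.
rewrite -sum_lmc_Qm; apply: sumr_le0 => j /andP[ji _].
by rewrite lmc_Qm_le0// eq_sym.
Qed.

Lemma gmc_Qp_ge0 i : 0 <= gQp i.
Proof.
rewrite -sum_lmc_Qp; apply: sumr_ge0 => j /andP[ji _].
by rewrite lmc_Qp_ge0// eq_sym.
Qed.

(** For a positive flux the minimum is at most [lQp i j] by construction. Its three arguments all
    exceed or equal [lQm i j], which is nonpositive, because none of them is negative. The other
    case is the mirror image. *)
Lemma lmc_flux_bounds i j : nbr M i j -> lQm i j <= flux LMC i j <= lQp i j.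
Proof.
case/andP; rewrite eq_sym => ij _; have ji : j != i by rewrite eq_sym.
have := (lmc_Qm_le0 i j ij, lmc_Qp_ge0 i j ij,
         lmc_Qm_le0 j i ji, lmc_Qp_ge0 j i ji).
move=> [[[mij pij] mji] pji] /=; rewrite /lmc_flux.
case: ltP => F0.
- rewrite !le_min !ge_min lexx /= andbT (le_trans mij pij).
  by rewrite (le_trans mij (ltW F0)) (le_trans mij)// oppr_ge0.
- rewrite !le_max !ge_max lexx /= (le_trans mij pij).
  by rewrite (le_trans F0 pij) (le_trans _ pij)// oppr_le0.
Qed.

(** * The GMC limiter *)

Lemma gmc_Pm_le0 i : Pm i <= 0.
Proof. by apply: sumr_le0 => j _; rewrite ge_min lexx. Qed.

Lemma gmc_Pp_ge0 i : 0 <= Pp i.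
Proof. by apply: sumr_ge0 => j _; rewrite le_max lexx. Qed.

Lemma gmc_Rm_ge0 i : 0 <= Rm i.
Proof.
rewrite /gmc_Rm; case: ifP => // _; rewrite le_min ler01/=.
by rewrite mulr_le0 ?invr_le0 ?gmc_Qm_le0 ?gmc_Pm_le0.
Qed.

Lemma gmc_Rp_ge0 i : 0 <= Rp i.
Proof.
rewrite /gmc_Rp; case: ifP => // _; rewrite le_min ler01/=.
by rewrite divr_ge0 ?gmc_Qp_ge0 ?gmc_Pp_ge0.
Qed.

(** If [Pm i] vanishes, only the sign of [gQm i] is at stake; otherwise the ratio in [Rm i] is
    multiplied by a negative number, which reverses the inequality. *)
Lemma gmc_Qm_le i : gQm i <= Rm i * Pm i.
Proof.
rewrite /gmc_Rm; have [->|P0] := eqVneq; first by rewrite mulr0 gmc_Qm_le0.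
have Plt0 : Pm i < 0 by rewrite lt_neqAle P0 gmc_Pm_le0.
by rewrite -ler_ndivlMr// ge_min lexx orbT.
Qed.

Lemma gmc_Qp_ge i : Rp i * Pp i <= gQp i.
Proof.
rewrite /gmc_Rp; have [->|P0] := eqVneq; first by rewrite mulr0 gmc_Qp_ge0.
have Pgt0 : 0 < Pp i by rewrite lt_neqAle eq_sym P0 gmc_Pp_ge0.
by rewrite -ler_pdivlMr// ge_min lexx orbT.
Qed.

(** In each sign case one bound is zero and needs only [0 <= gmc_alpha]; the other uses that
    [gmc_alpha] is at most the factor of cell [i]. The factor of cell [j] enters only through its
    sign. *)
Lemma gmc_flux_bounds i j :
  Rm i * Num.min 0 (F i j) <= flux GMC i j <= Rp i * Num.max 0 (F i j).
Proof.
rewrite /= /gmc_flux /gmc_alpha; case: ltgtP => [F0|F0|<-].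
- by rewrite mulr0 pmulr_lge0// ler_pM2r// le_min ge_min lexx gmc_Rp_ge0 gmc_Rm_ge0.
- by rewrite mulr0 nmulr_lle0// ler_nM2r// le_min ge_min lexx gmc_Rp_ge0 gmc_Rm_ge0.
- by rewrite !mulr0 lexx.
Qed.

Lemma sum_limited_flux_bounds lim i :
  gQm i <= \sum_(j | nbr M i j) flux lim i j <= gQp i.
Proof.
case: lim; apply/andP; split.
- rewrite -sum_lmc_Qm; apply: ler_sum => j ij.
  by case/andP: (lmc_flux_bounds i j ij).
- rewrite -sum_lmc_Qp; apply: ler_sum => j ij.
  by case/andP: (lmc_flux_bounds i j ij).
- apply: le_trans (gmc_Qm_le i) _; rewrite /gmc_Pm mulr_sumr.
  by apply: ler_sum => j _; case/andP: (gmc_flux_bounds i j).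
- apply: le_trans (gmc_Qp_ge i); rewrite /gmc_Pp mulr_sumr.
  by apply: ler_sum => j _; case/andP: (gmc_flux_bounds i j).
Qed.

(** * The forward Euler update *)

Lemma ubar_star_bounds lim i :
  (1 + gamma) * (umin i - u i) <=
    ubar_star M f lambda u uhat umin umax gamma lim i - u i <=
  (1 + gamma) * (umax i - u i).
Proof.
have := sum_limited_flux_bounds lim i; rewrite /ubar_star /gmc_Qm /gmc_Qp.
(* After division by [diag], the term [- ubarL] of both bounds cancels against the [ubarL] in
   [ubar_star]. *)
case/andP; rewrite -ler_pdivlMl ?diag_gt0// => lo.
rewrite -ler_pdivrMl ?diag_gt0// => hi.
by apply/andP; split; lra.
Qed.

Lemma euler_step_bounds lim dt i : 0 <= dt ->
  (1 + gamma) * (dt * diag M lambda i / vol M i) <= 1 ->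
  umin i <= euler_step M f lambda u uhat umin umax gamma lim dt i <= umax i.
Proof.
move=> dt0; rewrite /euler_step; set k := _ / vol M i => cfl.
have k0 : 0 <= k.
  by rewrite divr_ge0 ?mulr_ge0// ltW ?diag_gt0 ?vol_gt0.
have /andP[um uM] := u_bounds i; have /andP[sm sM] := ubar_star_bounds lim i.
apply/andP; split.
(* The update lowers [u i] by at most [(1 + gamma) * k] times its distance to [umin i], and the CFL
   condition makes this factor at most one. *)
- have := ler_wpM2l k0 sm; have : (1 + gamma) * k * (u i - umin i) <= u i - umin i.
    by rewrite ler_piMl ?subr_ge0.
  lra.
- have := ler_wpM2l k0 sM; have : (1 + gamma) * k * (umax i - u i) <= umax i - u i.
    by rewrite ler_piMl ?subr_ge0.
  lra.
Qed.

End LimitedFluxes.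

Theorem mainTheorem4 (R : realType) (d N : nat) (d_range : (1 <= d <= 3)%N)
  (M : mesh R d N)
  (f : R -> 'rV[R]_d)
  (f_derivable : forall v : R, derivable f v 1)
  (f_C1 : continuous (derive1 f))
  (lambda : 'I_N -> 'I_N -> R) (u : 'I_N -> R)
  (lambda_sym : forall i j, nbr M i j -> lambda i j = lambda j i)
  (lambda_gt0 : forall i j, nbr M i j -> 0 < lambda i j)
  (lambda_speed : forall i j, nbr M i j ->
     forall v : R, Num.min (u i) (u j) <= v <= Num.max (u i) (u j) ->
     `|dotp (derive1 f v) (normal M i j)| <= lambda i j)
  (uhat : 'I_N -> mpoly.mpoly d R)
  (umin umax : 'I_N -> R)
  (umin_le : forall i, umin i <= \big[Num.min/u i]_(j | vnbr M i j) u j)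
  (le_umax : forall i, \big[Num.max/u i]_(j | vnbr M i j) u j <= umax i)
  (gamma dt : R) (gamma_gt0 : 0 < gamma) (dt_gt0 : 0 < dt)
  (lim : limiter)
  (cfl : forall i, (1 + gamma) * (dt * diag M lambda i / vol M i) <= 1) :
  forall i,
    umin i <= euler_step M f lambda u uhat umin umax gamma lim dt i <= umax i.
Proof.
have umin_vnbr i j : vnbr M i j -> umin i <= u j.
  by move=> ij; apply: le_trans (umin_le i) _; exact: bigmin_le_cond.
have vnbr_umax i j : vnbr M i j -> u j <= umax i.
  by move=> ij; apply: le_trans (le_umax i); exact: le_bigmax_cond.
have vnbrr i : vnbr M i i by rewrite /vnbr eqxx.
move=> i; apply: euler_step_bounds => //; [exact: ltW| | |exact: ltW].
  by move=> k; rewrite umin_vnbr// vnbr_umax.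
(* A face neighbour is a vertex neighbour, so both states of the Riemann problem obey the bounds of
   cell [k]. *)
move=> k j kj; have vkj := nbr_vnbr kj.
have /andP[lo_face face_hi] := ubarL_face_bounds R d N M f lambda u k j
  f_derivable (lambda_gt0 k j kj) (lambda_speed k j kj).
apply/andP; split.
- by apply: le_trans lo_face; rewrite le_min !umin_vnbr.
- by apply: le_trans face_hi _; rewrite ge_max !vnbr_umax.
Qed.
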